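(* Let $d\ge4$ be an even integer. For $(p,q)\in\mathbb{R}^2$ let $$\mathcal{L}_{p,q}^{(d)}:M_d(\mathbb{C})\to M_d(\mathbb{C}),\qquad Z\mapsto(1-p-q)\frac{\operatorname{Tr}(Z)}{d}I_d+pZ+q\,\Omega_dZ^\top\Omega_d^*,$$ let $\mathbb{P}_k^{(d)}=\{(p,q)\in\mathbb{R}^2:\mathcal{L}_{p,q}^{(d)}\text{ is }k\text{-positive}\}$ and $\mathbb{D}^{(d)}=\{(p,q)\in\mathbb{R}^2:\mathcal{L}_{p,q}^{(d)}\text{ is decomposable}\}$. Then $\mathbb{P}_k^{(d)}\setminus\mathbb{D}^{(d)}$ is nonempty for all $k=1,\dots,\frac d2-1$, whereas $\mathbb{P}_{d/2}^{(d)}\subset\mathbb{D}^{(d)}$. In particular, $$\mathbb{P}_{d/2-1}^{(d)}\setminus\mathbb{D}^{(d)}=\Big\{(p,q)\in\mathbb{R}^2:\ p+q<-\tfrac{2+d}{d^2-d-2},\ \ p+(1-d)q\le1,\ \ \big(1-(\tfrac d2-1)d\big)p+q\le1\Big\},$$ and for $(p,q)$ in this set $\mathcal{L}_{p,q}^{(d)}$ is a $(\frac d2-1)$-positive indecomposable linear map on $M_d(\mathbb{C})$, while every $\frac d2$-positive $(S,S)$-covariant linear map on $M_d(\mathbb{C})$ is decomposable.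
   Context: $\Omega_d=\begin{pmatrix}0&I_{d/2}\\-I_{d/2}&0\end{pmatrix}$ and $Sp(d)=\{S\in U(d):S^\top\Omega_dS=\Omega_d\}$. A linear map $\mathcal{L}$ on $M_d(\mathbb{C})$ is $(S,S)$-covariant if $\mathcal{L}(SZS^* )=S\mathcal{L}(Z)S^*$ for all $S\in Sp(d)$, $Z\in M_d(\mathbb{C})$. $\mathcal{L}$ is $k$-positive if $\mathrm{id}_k\otimes\mathcal{L}$ maps positive semidefinite matrices to positive semidefinite matrices; completely positive (CP) if $k$-positive for all $k$; completely copositive (co-CP) if $\top\circ\mathcal{L}$ is CP, where $\top(Z)=Z^\top$; decomposable if it is the sum of a CP and a co-CP map, indecomposable otherwise. *)

(* Defs.v *)
From HB Require Import structures.
From mathcomp Require Import all_boot all_order all_algebra.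
From mathcomp Require Import zify complex.
From mathcomp Require Import boolp classical_sets reals.

Set Implicit Arguments.
Unset Strict Implicit.
Unset Printing Implicit Defensive.

Import Order.TTheory GRing.Theory Num.Theory.
Local Open Scope ring_scope.
Local Open Scope complex_scope.
Local Open Scope sesquilinear_scope.
Local Open Scope classical_set_scope.

Definition psd (R : realType) (n : nat) (A : 'M[R[i]]_n) : Prop :=
  A \is hermsymmx /\ forall v : 'cV[R[i]]_n, 0 <= (v^t* *m A *m v) 0 0.

(* M_k (x) M_d is identified with the k x k block matrices over M_d, so that
   E_ab (x) Z has Z in block (a, b). *)
Definition id_tens (R : realType) (k d : nat) (L : 'M[R[i]]_d -> 'M[R[i]]_d)
    (X : 'M[R[i]]_(\sum_(a < k) d)) : 'M[R[i]]_(\sum_(a < k) d) :=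
  \mxblock_(a < k, b < k) L (submxblock X a b).

Lemma id_tens_block (R : realType) (k d : nat)
    (L : {linear 'M[R[i]]_d -> 'M[R[i]]_d}) (A : 'M[R[i]]_k) (Z : 'M[R[i]]_d) :
  id_tens L (\mxblock_(a < k, b < k) (A a b *: Z)) =
  \mxblock_(a < k, b < k) (A a b *: L Z).
Proof. by apply: eq_mxblock => a b; rewrite mxblockK linearZ. Qed.

Definition k_positive (R : realType) (k d : nat)
    (L : 'M[R[i]]_d -> 'M[R[i]]_d) : Prop :=
  forall X : 'M[R[i]]_(\sum_(a < k) d), psd X -> psd (id_tens L X).

Definition CP (R : realType) (d : nat) (L : 'M[R[i]]_d -> 'M[R[i]]_d) : Prop :=
  forall k : nat, k_positive k L.

Definition coCP (R : realType) (d : nat) (L : 'M[R[i]]_d -> 'M[R[i]]_d) : Prop :=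
  CP (fun Z => (L Z)^T).

Definition decomposable (R : realType) (d : nat)
    (L : 'M[R[i]]_d -> 'M[R[i]]_d) : Prop :=
  exists L1 L2 : {linear 'M[R[i]]_d -> 'M[R[i]]_d},
    [/\ CP L1, coCP L2 & forall Z, L Z = L1 Z + L2 Z].

Definition indecomposable (R : realType) (d : nat)
    (L : 'M[R[i]]_d -> 'M[R[i]]_d) : Prop := ~ decomposable L.

(* Entrywise, so that no cast between d and d./2 + d./2 is needed; only
   meaningful for even d, see Omega_block. *)
Definition Omega (R : realType) (d : nat) : 'M[R[i]]_d :=
  \matrix_(i < d, j < d)
    ((nat_of_ord j == i + d./2)%N%:R - (nat_of_ord i == j + d./2)%N%:R).

Lemma Omega_block (R : realType) (m : nat) :
  Omega R (m + m) = block_mx 0 1%:M (- 1%:M) 0.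
Proof.
apply/matrixP => i j; rewrite !mxE (_ : (m + m)./2 = m); last by lia.
case: (split_ordP i) => a ->; rewrite !mxE;
  case: (split_ordP j) => b ->; rewrite !mxE /= -?val_eqE /=;
  have := ltn_ord a; have := ltn_ord b => hb ha.
- rewrite (_ : (b == a + m :> nat)%N = false); last by lia.
  by rewrite (_ : (a == b + m :> nat)%N = false) ?subrr //; lia.
- rewrite (_ : (m + b == a + m)%N = (a == b :> nat)%N); last by lia.
  by rewrite (_ : (_ == m + b + m)%N = false) ?subr0 //; lia.
- rewrite (_ : (m + a == b + m)%N = (a == b :> nat)%N); last by lia.
  by rewrite (_ : (_ == m + a + m)%N = false) ?sub0r //; lia.
- rewrite (_ : (m + b == m + a + m)%N = false); last by lia.
  by rewrite (_ : (m + a == m + b + m)%N = false) ?subrr //; lia.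
Qed.

Definition Sp (R : realType) (d : nat) : set 'M[R[i]]_d :=
  [set S | S \is unitarymx /\ S^T *m Omega R d *m S = Omega R d].

Definition SS_covariant (R : realType) (d : nat)
    (L : 'M[R[i]]_d -> 'M[R[i]]_d) : Prop :=
  forall S Z : 'M[R[i]]_d, Sp S -> L (S *m Z *m S^t*) = S *m L Z *m S^t*.

Definition Lpq (R : realType) (d : nat) (p q : R) (Z : 'M[R[i]]_d) :
    'M[R[i]]_d :=
  ((1 - p - q)%:C * (\tr Z / d%:R)) *: 1%:M + p%:C *: Z
  + q%:C *: (Omega R d *m Z^T *m (Omega R d)^t*).

Definition PP (R : realType) (d k : nat) : set (R * R) :=
  [set x | k_positive k (@Lpq R d x.1 x.2)].

Definition DD (R : realType) (d : nat) : set (R * R) :=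
  [set x | decomposable (@Lpq R d x.1 x.2)].

Arguments PP : clear implicits.
Arguments DD : clear implicits.

(* Main.v *)
(* Put m = d/2 and M# = Omega M^T Omega^*. For L = a Tr I + b Z + c Z# the Choi
   form at the vector with matrix M is
     a |M|^2 + b |tr M|^2 - c <M, M#>,
   and L is k-positive iff this is nonnegative for all M of rank at most k.
   Testing M on matrix units and on a coordinate projection of rank k gives
   a >= 0, a + b >= 0, a + c >= 0 and, for k <= m, a + k b >= 0. Conversely, if
   c <= 0, the bounds |tr M|^2 <= k |M|^2 and 2 |tr M|^2 <= k |M + M#|^2 for
   rank at most k show that a + c >= 0 and a + k b >= 0 suffice.
   L is decomposable iff a >= 0, a + b >= 0, a + c >= 0 and
   (m+1) a + m (b + c) >= 0. Such a triple is a nonnegative combination of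
   (m, -1, -m) and (0, 1, 0), which are CP, and their images under exchanging b
   and c, which are co-CP. The last inequality is the pairing of L with the map
   (1, 1, 1), which is both CP and co-CP. For k = m it follows from a + m b >= 0
   and a + c >= 0.
   Finally an (S,S)-covariant L sends E_11 to a matrix commuting with the
   stabilizer of the line of e_1, hence to a I + b E_11 + c E_11#, and the orbit
   of E_11 spans all matrices, so L belongs to the family. *)
From HB Require Import structures.
Require Import Defs.
From mathcomp Require Import all_boot all_order all_algebra.
From mathcomp Require Import complex.
From mathcomp Require Import boolp classical_sets reals.
From mathcomp Require Import zify ring lra.

Set Implicit Arguments.
Unset Strict Implicit.
Unset Printing Implicit Defensive.

Import Order.TTheory GRing.Theory Num.Theory.
Local Open Scope ring_scope.
Local Open Scope classical_set_scope.
Local Open Scope sesquilinear_scope.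

(** * Adjoints and Hermitian forms *)

Section Psd.
Variable C : numClosedFieldType.

Lemma adj_mul m n p (A : 'M[C]_(m, n)) (B : 'M[C]_(n, p)) :
  (A *m B)^t* = B^t* *m A^t*.
Proof. by rewrite trmx_mul map_mxM. Qed.

Lemma adj_add m n (A B : 'M[C]_(m, n)) : (A + B)^t* = A^t* + B^t*.
Proof. by rewrite linearD /= map_mxD. Qed.

Lemma adj_scale m n a (A : 'M[C]_(m, n)) : (a *: A)^t* = a^* *: A^t*.
Proof. by rewrite linearZ /= map_mxZ. Qed.

Lemma mxtrace_adj n (A : 'M[C]_n) : \tr (A^t*) = (\tr A)^*.
Proof.
rewrite -map_trmx mxtrace_tr /mxtrace rmorph_sum.
by under eq_bigr do rewrite mxE.
Qed.

Lemma delta_formE n (A : 'M[C]_n) i j :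
  ((delta_mx i 0 : 'cV_n)^t* *m A *m (delta_mx j 0 : 'cV_n)) 0 0 = A i j.
Proof.
by rewrite -colE mxE trmx_delta map_delta_mx -rowE mxE.
Qed.

(* The form of [A - A^t*] vanishes, so polarization applies. *)
Lemma form_ge0_hermsym n (A : 'M[C]_n) :
  (forall v : 'cV_n, 0 <= (v^t* *m A *m v) 0 0) -> A \is hermsymmx.
Proof.
move=> A_ge0; apply/is_hermitianmxP; rewrite expr0 scale1r.
apply/eqP; rewrite -subr_eq0; apply/eqP; set B := A - _.
have B0 (v : 'cV_n) : (v^t* *m B *m v) 0 0 = 0.
  rewrite mulmxBr mulmxBl.
  have -> : v^t* *m A^t* *m v = (v^t* *m A *m v)^t*.
    by rewrite !adj_mul trmxCK mulmxA.
  have /conj_Creal fE := ger0_real (A_ge0 v).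
  by move: fE; set F := v^t* *m A *m v; rewrite !mxE => ->; rewrite subrr.
move: B B0 => B B0; have Bd i : B i i = 0 by rewrite -delta_formE B0.
have addE (X Y : 'M[C]_1) : (X + Y) 0 0 = X 0 0 + Y 0 0 by rewrite mxE.
have scaleE a (X : 'M[C]_1) : (a *: X) 0 0 = a * X 0 0 by rewrite mxE.
have Bt t i j : t * B i j + t^* * B j i = 0.
  have := B0 (delta_mx i 0 + t *: delta_mx j 0).
  rewrite adj_add adj_scale !mulmxDl !mulmxDr -!scalemxAl -!scalemxAr.
  by rewrite !(addE, scaleE) !delta_formE !Bd !mulr0 add0r addr0.
apply/matrixP=> i j; rewrite [RHS]mxE.
have := Bt 1 i j; have := Bt 'i i j.
rewrite rmorph1 !mul1r conjCi mulNr -mulrBr => /eqP.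
rewrite mulf_eq0 (negbTE (neq0Ci _)) /= subr_eq0 => /eqP <- /eqP.
by rewrite -mulr2n mulrn_eq0 /= => /eqP.
Qed.

(* The form of [id_tens L X] at [v] for [X = w *m w^t*], where the columns of [W]
   and [V] are the blocks of [w] and [v]. *)
Definition quad n k (L : 'M[C]_n -> 'M[C]_n) (W V : 'M[C]_(n, k)) : C :=
  \sum_a \sum_b
    ((col a V)^t* *m L (col a W *m (col b W)^t*) *m col b V) 0 0.

End Psd.

(** * The family [Lc] and its Choi form *)

Section Choi.
Variables (C : numClosedFieldType) (m : nat).
Local Notation d := (m + m)%N.

Definition symp : 'M[C]_d := block_mx 0 1%:M (- 1%:M) 0.
Local Notation Om := symp.

Lemma symp_tr : Om^T = - Om.
Proof.
by rewrite /symp tr_block_mx opp_block_mx !linear0 !linearN /= !trmx1 opprK.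
Qed.

Lemma symp_conj : map_mx Num.conj Om = Om.
Proof. by rewrite /symp map_block_mx map_mxN map_mx1 !map_mx0. Qed.

Lemma symp_adj : Om^t* = - Om.
Proof. by rewrite -map_trmx symp_conj symp_tr. Qed.

Lemma symp_sqr : Om *m Om = - 1%:M.
Proof.
rewrite /symp mulmx_block !(mul0mx, mulmx0, mul1mx, mulmx1, addr0, add0r).
by rewrite (scalar_mx_block m m) opp_block_mx oppr0.
Qed.

Lemma mulsympK n (A : 'M[C]_(n, d)) : A *m Om *m Om = - A.
Proof. by rewrite -mulmxA symp_sqr mulmxN mulmx1. Qed.

Lemma symp_unitary : Om *m Om^t* = 1%:M.
Proof. by rewrite symp_adj mulmxN symp_sqr opprK. Qed.

Definition sharp (M : 'M[C]_d) : 'M[C]_d := Om *m M^T *m Om^t*.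

Lemma sharp_is_linear : linear sharp.
Proof.
move=> a A B; rewrite /sharp linearP /= mulmxDr mulmxDl.
by rewrite -scalemxAr -scalemxAl.
Qed.

HB.instance Definition _ :=
  GRing.isLinear.Build C 'M[C]_d 'M[C]_d _ sharp sharp_is_linear.

Lemma sharpE M : sharp M = - (Om *m M^T *m Om).
Proof. by rewrite /sharp symp_adj mulmxN. Qed.

Lemma sharpK M : sharp (sharp M) = M.
Proof.
rewrite !sharpE linearN /= !trmx_mul trmxK symp_tr !(mulNmx, mulmxN) !opprK.
by rewrite !mulmxA mulsympK symp_sqr !mulNmx mul1mx opprK.
Qed.

Lemma sharp1 : sharp 1%:M = 1%:M.
Proof. by rewrite /sharp trmx1 mulmx1 symp_unitary. Qed.

Lemma mxtrace_sharp M : \tr (sharp M) = \tr M.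
Proof.
rewrite sharpE linearN /= mxtrace_mulC mulmxA symp_sqr mulNmx mul1mx.
by rewrite linearN /= opprK mxtrace_tr.
Qed.

(** A factorization through dimension [n] survives [sharp]; this is what bounds the rank of
    [M + sharp M]. *)
Lemma sharp_mul n (A : 'M[C]_(d, n)) (B : 'M[C]_(n, d)) :
  sharp (A *m B) = (Om *m B^T) *m (A^T *m Om^t*).
Proof. by rewrite /sharp trmx_mul !mulmxA. Qed.

(** The trace normalization is absorbed into [a], so that transposition simply exchanges [b] and
    [c]. *)
Definition Lc (a b c : C) (Z : 'M[C]_d) : 'M[C]_d :=
  (a * \tr Z) *: 1%:M + b *: Z + c *: sharp Z.

Lemma Lc_is_linear a b c : linear (Lc a b c).
Proof.
move=> t A B; rewrite /Lc !linearP /=.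
move: (sharp A) (sharp B) => A' B'; apply/matrixP => i j; rewrite !mxE; ring.
Qed.

HB.instance Definition _ a b c :=
  GRing.isLinear.Build C 'M[C]_d 'M[C]_d _ (Lc a b c) (Lc_is_linear a b c).

(** The squared Frobenius norm. *)
Definition frob n (M : 'M[C]_n) : C := \tr (M *m M^t*).

Lemma frob_ge0 n (M : 'M[C]_n) : 0 <= frob M.
Proof.
apply: sumr_ge0 => i _; rewrite mxE; apply: sumr_ge0 => j _.
by rewrite !mxE mul_conjC_ge0.
Qed.

(* The Choi form of [Lc a b c] at the vector with matrix [M]; [c] enters with a
   minus sign since [Om] is antisymmetric. *)
Definition choi (a b c : C) (M : 'M[C]_d) : C :=
  a * frob M + b * (\tr M * (\tr M)^*) - c * \tr (M *m (sharp M)^t*).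

(** On a rank-one block every summand of [Lc] contributes a product of two matrix entries; the
    double sum over blocks collapses these products into the three traces of [choi]. *)
Lemma quad_Lc k a b c (W V : 'M[C]_(d, k)) :
  quad (Lc a b c) W V = choi a b c (W *m V^t*).
Proof.
have cce (n p : nat) (A : 'M[C]_(n, p)) (X : 'M[C]_(p, n)) i j :
    (row i A *m col j X) 0 0 = (A *m X) i j.
  by rewrite !mxE; apply: eq_bigr => s _; rewrite !mxE.
have adj_col n (A : 'M[C]_(n, k)) i : (col i A)^t* = row i (A^t*).
  by apply/rowP => j; rewrite !mxE.
have tr_col' n (A : 'M[C]_(n, k)) i : (col i A)^T = row i (A^T).
  by apply/rowP => j; rewrite !mxE.
have dbl (A B : 'M[C]_k) : \sum_i \sum_j A i j * B j i = \tr (A *m B).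
  by apply: eq_bigr => i _; rewrite mxE.
have m11 (A B : 'M[C]_1) : (A *m B) 0 0 = A 0 0 * B 0 0 by rewrite mxE big_ord1.
have termE i j :
  ((col i V)^t* *m Lc a b c (col i W *m (col j W)^t*) *m col j V) 0 0
  = a * ((V^t* *m V) i j * (W^t* *m W) j i)
    + b * ((V^t* *m W) i i * (W^t* *m V) j j)
    - c * ((V^t* *m Om *m map_mx Num.conj W) i j
            * (W^T *m Om *m V) i j).
  rewrite /Lc /sharp symp_adj mulmxDr mulmxDl mulmxDr mulmxDl.
  rewrite -!scalemxAr -!scalemxAl mulmx1.
  have addE (X Y : 'M[C]_1) : (X + Y) 0 0 = X 0 0 + Y 0 0 by rewrite mxE.
  have scaleE t (X : 'M[C]_1) : (t *: X) 0 0 = t * X 0 0 by rewrite mxE.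
  have oppE (X : 'M[C]_1) : (- X) 0 0 = - X 0 0 by rewrite mxE.
  rewrite !(addE, scaleE) mxtrace_mulC trace_mx11 !adj_col !cce.
  congr (_ + _ + _); first by rewrite mulrAC mulrA.
    by rewrite mulmxA -(mulmxA (row i _ *m col i W)) m11 !cce.
  rewrite !mulmxN !mulNmx oppE mulrN; congr (- (_ * _)).
  have -> : (col i W *m row j (W^t*))^T =
      col j (map_mx Num.conj W) *m row i W^T.
    rewrite trmx_mul tr_col'; congr (_ *m _).
    by apply/colP => s; rewrite !mxE.
  rewrite !mulmxA -row_mul -!(mulmxA (row i _ *m col j _)) -(row_mul i W^T).
  by rewrite m11 !cce.
rewrite /quad; under eq_bigr => i _ do under eq_bigr => j _ do rewrite termE.
under eq_bigr do rewrite !big_split /=; rewrite !big_split /=.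
under [X in _ + _ + X]eq_bigr do rewrite sumrN.
rewrite sumrN; congr (_ + _ - _).
- under eq_bigr do rewrite -mulr_sumr; rewrite -mulr_sumr dbl; congr (_ * _).
  rewrite /frob adj_mul trmxCK mulmxA mxtrace_mulC !mulmxA.
  by rewrite mxtrace_mulC !mulmxA.
- under eq_bigr do rewrite -mulr_sumr -mulr_sumr.
  rewrite -mulr_sumr -mulr_suml; congr (_ * (_ * _)).
    exact: mxtrace_mulC.
  by rewrite -mxtrace_adj adj_mul trmxCK mxtrace_mulC.
- under eq_bigr do rewrite -mulr_sumr; rewrite -mulr_sumr; congr (_ * _).
  set A := _ *m map_mx _ W; set B := W^T *m Om *m V.
  (* Both factors carry the indices in the same order, so the second is transposed to form a
     trace. *)
  have -> : \sum_i \sum_j A i j * B i j = \tr (A *m B^T).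
    apply: eq_bigr => i _; rewrite mxE; apply: eq_bigr => j _.
    by rewrite [B^T j i]mxE.
  rewrite sharpE /A /B !trmx_mul trmxK symp_tr.
  have -> : (V^t*)^T = (V^T)^t* by rewrite map_trmx.
  rewrite linearN map_mxN /= !adj_mul trmxCK trmxK symp_adj.
  rewrite !(mulNmx, mulmxN) !opprK !linearN /=; congr (- _).
  by rewrite !mulmxA mxtrace_mulC !mulmxA.
Qed.

Lemma adj_sharp M : (sharp M)^t* = sharp (M^t*).
Proof. by rewrite /sharp !adj_mul trmxCK mulmxA map_trmx. Qed.

Lemma sharpM (A B : 'M[C]_d) : sharp (A *m B) = sharp B *m sharp A.
Proof.
rewrite !sharpE trmx_mul mulmxN mulNmx opprK !mulmxA mulsympK.
by rewrite !mulNmx.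
Qed.

Lemma frob_sharp M : frob (sharp M) = frob M.
Proof. by rewrite /frob adj_sharp -sharpM mxtrace_sharp mxtrace_mulC. Qed.

Lemma mxtrace_sharp_adj M : \tr (sharp M *m M^t*) = \tr (M *m (sharp M)^t*).
Proof.
by rewrite -{2}[M]sharpK adj_sharp -sharpM mxtrace_sharp mxtrace_mulC.
Qed.

Lemma frob_add_sharp M :
  frob (M + sharp M) = (frob M + \tr (M *m (sharp M)^t*)) *+ 2.
Proof.
rewrite {1}/frob adj_add mulmxDr !mulmxDl !linearD /= -!/(frob _).
by rewrite frob_sharp mxtrace_sharp_adj; ring.
Qed.

Lemma frob_sub_sharp M :
  frob (M - sharp M) = (frob M - \tr (M *m (sharp M)^t*)) *+ 2.
Proof.
rewrite {1}/frob -scaleN1r adj_add adj_scale rmorphN1.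
rewrite mulmxDr !mulmxDl -!scalemxAl -!scalemxAr.
rewrite !linearD !linearZ /= -!/(frob _).
by rewrite frob_sharp mxtrace_sharp_adj; ring.
Qed.

(* With [P] the orthogonal projection onto a [k]-dimensional space containing
   the row space of [M], the bound is [0 <= frob (M - (\tr M / k) *: P)]. *)
Lemma trace_le_frob n k (A : 'M[C]_(n, k)) (B : 'M[C]_(k, n)) :
  (0 < k <= n)%N ->
  \tr (A *m B) * (\tr (A *m B))^* <= k%:R * frob (A *m B).
Proof.
case/andP=> k_gt0 k_le; set M := A *m B.
(* Since [k <= n], even dependent rows of [B] lie in the span of [k] orthonormal ones. *)
set U := schmidt B; have UU : U *m U^t* = 1%:M.
  by apply/unitarymxP/schmidt_unitarymx.
have [N NE] : exists N, M = N *m U.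
  have /submxP [D BE] := schmidt_sub B.
  by exists (A *m D); rewrite /M {1}BE mulmxA.
set P := U^t* *m U; have MP : M *m P = M.
  by rewrite NE /P mulmxA -(mulmxA N) UU mulmx1.
have Pa : P^t* = P by rewrite /P adj_mul trmxCK.
have PP : P *m P = P by rewrite /P mulmxA -(mulmxA _ U) UU mulmx1.
have trP : \tr P = k%:R by rewrite /P mxtrace_mulC UU mxtrace1.
have PM : P *m M^t* = M^t* by rewrite -{1}Pa -adj_mul MP.
have k0 : k%:R != 0 :> C by rewrite pnatr_eq0 -lt0n.
have expand t : frob (M + t *: P) =
    frob M + t * (\tr M)^* + t^* * \tr M + t * t^* * k%:R.
  rewrite {1}/frob adj_add adj_scale Pa mulmxDr !mulmxDl.
  rewrite -!scalemxAl -!scalemxAr !linearD !linearZ /= -/(frob _) MP PM PP trP.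
  by rewrite mxtrace_adj mulrA !addrA.
have := frob_ge0 (M + (- (\tr M / k%:R)) *: P).
rewrite expand rmorphN rmorphM /= fmorphV rmorph_nat.
move: (\tr M) (frob M) => t F h; rewrite -subr_ge0.
rewrite (_ : _ - _ = k%:R * (F - t / k%:R * t^* - t^* / k%:R * t
  + t / k%:R * (t^* / k%:R) * k%:R)).
  by rewrite mulr_ge0 ?ler0n //; move: h; rewrite mulrNN !mulNr.
by field.
Qed.


Lemma mxtrace_add_sharp M : \tr (M + sharp M) = \tr M *+ 2.
Proof. by rewrite linearD /= mxtrace_sharp mulr2n. Qed.

Lemma sqr_mxtrace_ge0 n (M : 'M[C]_n) : 0 <= \tr M * (\tr M)^*.
Proof. exact: mul_conjC_ge0. Qed.

(** [M + sharp M] factors through dimension [k + k] and has trace [2 \tr M], so [trace_le_frob]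
    applies to it; [k <= m] ensures that [k + k] is at most [d]. *)
Lemma trace_le_frob_add_sharp k (A : 'M[C]_(d, k)) (B : 'M[C]_(k, d)) M :
  (0 < k <= m)%N -> M = A *m B ->
  (\tr M * (\tr M)^*) *+ 2 <= k%:R * frob (M + sharp M).
Proof.
move=> /andP[k_gt0 k_le] MAB.
have ME : M + sharp M = row_mx A (Om *m B^T) *m col_mx B (A^T *m Om^t*).
  by rewrite mul_row_col -sharp_mul MAB.
have kk : (0 < k + k <= d)%N by lia.
have := trace_le_frob (row_mx A (Om *m B^T)) (col_mx B (A^T *m Om^t*)) kk.
rewrite -ME mxtrace_add_sharp rmorphMn /=.
rewrite natrD -subr_ge0 => h; rewrite -subr_ge0.
have -> : k%:R * frob (M + sharp M) - (\tr M * (\tr M)^*) *+ 2 =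
  2^-1 * ((k%:R + k%:R) * frob (M + sharp M) - \tr M *+ 2 * ((\tr M)^* *+ 2)).
  by field.
by rewrite mulr_ge0 ?invr_ge0 ?ler0n.
Qed.

(** Trading the mixed trace for the norm of [M + sharp M] leaves, when [c <= 0], a term in [c] that
    is nonnegative. *)
Lemma choi_sharp a b c M :
  choi a b c M = (a + c) * frob M + b * (\tr M * (\tr M)^*)
    - c * (2^-1 * frob (M + sharp M)).
Proof. by rewrite /choi frob_add_sharp; field. Qed.

(** Multiplied by [k], the form is a combination of the gaps in the two trace bounds and of the
    squared trace, with coefficients [a + c], [- c / 2] and [a + k b]. *)
Lemma choi_rank_ge0 k a b c (W V : 'M[C]_(d, k)) : (0 < k <= m)%N ->
  c <= 0 -> 0 <= a + c -> 0 <= a + k%:R * b -> 0 <= choi a b c (W *m V^t*).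
Proof.
move=> k_bnd c_le0 ac_ge0 akb_ge0.
have k_bnd' : (0 < k <= d)%N by lia.
have h1 := trace_le_frob W (V^t*) k_bnd'.
have h2 := trace_le_frob_add_sharp k_bnd (erefl (W *m V^t*)).
move: h1 h2; move: (W *m _) => M h1 h2.
have k_gt0 : 0 < k%:R :> C by rewrite ltr0n; lia.
rewrite -(pmulr_rge0 _ k_gt0) choi_sharp.
have T_ge0 := sqr_mxtrace_ge0 M.
move: h1 h2 T_ge0.
move: (\tr M * _) (frob M) (frob (M + _)) => T F F' h1 h2 T_ge0.
have -> : k%:R * ((a + c) * F + b * T - c * (2^-1 * F')) =
  (a + c) * (k%:R * F - T) + (- c) * (2^-1 * (k%:R * F' - T *+ 2))
  + (a + k%:R * b) * T by field.
by rewrite !addr_ge0 ?mulr_ge0 ?oppr_ge0 ?subr_ge0 ?invr_ge0 ?ler0n.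
Qed.

(** The coefficients are [s (m, -1, -m) + t (0, 1, 0)]. The norm term cancels because [a + c = 0],
    and the rest is the trace bound for [M + sharp M] at full rank [d]. *)
Lemma choi_extreme_ge0 s t M : (0 < m)%N -> 0 <= s -> 0 <= t ->
  0 <= choi (m%:R * s) (t - s) (- (m%:R * s)) M.
Proof.
move=> m_gt0 s_ge0 t_ge0; rewrite choi_sharp subrr mul0r add0r.
have d_bnd : (0 < d <= d)%N by lia.
have := trace_le_frob (M + sharp M) 1%:M d_bnd.
rewrite mulmx1 mxtrace_add_sharp rmorphMn /=.
have T_ge0 := sqr_mxtrace_ge0 M.
move: T_ge0; move: (\tr M) (frob _) => t' F T_ge0; rewrite natrD -subr_ge0 => h.
have -> : (t - s) * (t' * t'^*) - - (m%:R * s) * (2^-1 * F) =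
  t * (t' * t'^*) + 4^-1 * s * ((m%:R + m%:R) * F - t' *+ 2 * (t'^* *+ 2)).
  by field.
apply: addr_ge0; first exact: mulr_ge0.
by rewrite !mulr_ge0 ?invr_ge0 ?ler0n.
Qed.

(** The form is half the squared norm of [M - sharp M] plus the squared trace. *)
Lemma choi1_ge0 M : 0 <= choi 1 1 1 M.
Proof.
rewrite /choi.
have := frob_ge0 (M - sharp M); rewrite frob_sub_sharp pmulrn_lge0 // => h.
by rewrite !mul1r addrAC addr_ge0 // sqr_mxtrace_ge0.
Qed.

Let simp_block := (trmx0, map_mx0, mul0mx, mulmx0, mul1mx, mulmx1,
  @addr0, @add0r, mulNmx, mulmxN, mxtrace_block).

(** [sharp] moves the upper left block to the lower right, orthogonally to [M], so [c] drops out. *)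
Lemma choi_ul a b c (N : 'M[C]_m) :
  choi a b c (block_mx N 0 0 0 : 'M_(m + m)) =
  a * frob N + b * (\tr N * (\tr N)^*).
Proof.
rewrite /choi /frob sharpE /symp tr_block_mx map_block_mx !mulmx_block.
rewrite !(simp_block, oppr0, opprK) opp_block_mx tr_block_mx.
rewrite map_block_mx mulmx_block.
rewrite !(simp_block, oppr0, opprK) ?linear0 !(simp_block, oppr0, opprK).
by rewrite mulr0 subr0.
Qed.

(** [M] has trace zero, so [b] drops out; [sharp] replaces the block [N] by [- N^T], which turns the
    sign of [c] into a plus. *)
Lemma choi_ur a b c (N : 'M[C]_m) :
  choi a b c (block_mx 0 N 0 0 : 'M_(m + m)) =
  a * frob N + c * \tr (N *m map_mx Num.conj N).
Proof.
rewrite /choi /frob sharpE /symp tr_block_mx map_block_mx !mulmx_block.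
rewrite !(simp_block, oppr0, opprK) opp_block_mx tr_block_mx.
rewrite map_block_mx mulmx_block.
rewrite !(simp_block, oppr0, opprK) ?linear0 !(simp_block, oppr0, opprK).
rewrite mul0r mulr0 addr0.
by rewrite linearN map_mxN /= trmxK mulmxN linearN mulrN opprK.
Qed.

(** * Necessary conditions from test matrices of rank at most [k] *)

Section Necessary.
Variables (k : nat) (a b c : C).
Hypothesis k_gt0 : (0 < k)%N.
Hypothesis choi_ge0 : forall W V : 'M[C]_(d, k), 0 <= choi a b c (W *m V^t*).

Let choi_ul_ge0 (W V : 'M[C]_(m, k)) :
  0 <= a * frob (W *m V^t*) + b * (\tr (W *m V^t*) * (\tr (W *m V^t*))^*).
Proof.
have := choi_ge0 (col_mx W 0) (col_mx V 0).
by rewrite tr_col_mx map_row_mx mul_col_row !(simp_block, oppr0, opprK) choi_ul.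
Qed.

Let choi_ur_ge0 (W V : 'M[C]_(m, k)) :
  0 <= a * frob (W *m V^t*)
       + c * \tr ((W *m V^t*) *m map_mx Num.conj (W *m V^t*)).
Proof.
have := choi_ge0 (col_mx W 0) (col_mx 0 V).
by rewrite tr_col_mx map_row_mx mul_col_row !(simp_block, oppr0, opprK) choi_ur.
Qed.

Let delta_mulE i j (a0 := Ordinal k_gt0) :
  (delta_mx i a0 : 'M[C]_(m, k)) *m (delta_mx j a0 : 'M[C]_(m, k))^t*
  = delta_mx i j.
Proof. by rewrite trmx_delta map_delta_mx mul_delta_mx. Qed.

Let mxtrace_delta i j : \tr (delta_mx i j : 'M[C]_m) = (i == j)%:R.
Proof.
rewrite /mxtrace (bigD1 i) //= big1 ?addr0 => [|s]; rewrite mxE ?eqxx //.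
by move=> /negPf ->.
Qed.

Let frob_delta i j : frob (delta_mx i j : 'M[C]_m) = 1.
Proof.
by rewrite /frob trmx_delta map_delta_mx mul_delta_mx mxtrace_delta eqxx.
Qed.

(** An off-diagonal matrix unit in the upper left block has trace zero; [2 <= m] provides its two
    indices. *)
Lemma choi_a_ge0 : (2 <= m)%N -> 0 <= a.
Proof.
move=> m_ge2; pose i0 := Ordinal (ltnW m_ge2); pose i1 := Ordinal m_ge2.
have := choi_ul_ge0 (delta_mx i0 (Ordinal k_gt0)) (delta_mx i1 (Ordinal k_gt0)).
by rewrite delta_mulE frob_delta mxtrace_delta mul0r mulr0 addr0 mulr1.
Qed.

Lemma choi_ab_ge0 : (0 < m)%N -> 0 <= a + b.
Proof.
move=> m_gt0; pose i0 := Ordinal m_gt0.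
have := choi_ul_ge0 (delta_mx i0 (Ordinal k_gt0)) (delta_mx i0 (Ordinal k_gt0)).
by rewrite delta_mulE frob_delta mxtrace_delta eqxx rmorph_nat /= !mulr1.
Qed.

Lemma choi_ac_ge0 : (0 < m)%N -> 0 <= a + c.
Proof.
move=> m_gt0; pose i0 := Ordinal m_gt0.
have := choi_ur_ge0 (delta_mx i0 (Ordinal k_gt0)) (delta_mx i0 (Ordinal k_gt0)).
rewrite delta_mulE frob_delta map_delta_mx mul_delta_mx mxtrace_delta eqxx.
by rewrite /= !mulr1.
Qed.

Lemma choi_akb_ge0 : (k <= m)%N -> 0 <= a + k%:R * b.
Proof.
move=> k_le; have := choi_ul_ge0 (pid_mx k) (pid_mx k).
have -> : (pid_mx k : 'M[C]_(m, k)) *m (pid_mx k : 'M[C]_(m, k))^t* = pid_mx k.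
  by rewrite tr_pid_mx map_pid_mx pid_mx_id.
have trE : \tr (pid_mx k : 'M[C]_m) = k%:R.
  rewrite /mxtrace; under eq_bigr do rewrite mxE eqxx /=.
  rewrite -natr_sum -big_mkcond /= -(big_ord_widen m (fun=> 1%N) k_le).
  by rewrite sum1_card card_ord.
rewrite /frob tr_pid_mx map_pid_mx pid_mx_id // trE rmorph_nat.
have k_gt0' : 0 < k%:R :> C by rewrite ltr0n.
by rewrite mulrA -mulrDl [b * _]mulrC pmulr_lge0.
Qed.

End Necessary.

(** [Z^T] is the conjugate of [sharp Z] by [Om], and the transpose of [sharp Z] is that of [Z]. This
    reduces co-CP to CP with [b] and [c] exchanged. *)
Lemma Lc_tr_out a b c Z : (Lc a b c Z)^T = Om *m Lc a c b Z *m Om^t*.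
Proof.
rewrite /Lc !linearD !linearZ /= !mulmxDl -!scalemxAl trmx1 mulmx1 symp_unitary.
rewrite addrAC; congr (_ + _ *: _ + _ *: _).
  by rewrite sharpE linearN /= !trmx_mul trmxK symp_adj symp_tr
     !(mulNmx, mulmxN) !opprK mulmxA.
by rewrite /sharp symp_adj !(mulNmx, mulmxN) !opprK !mulmxA mulsympK symp_sqr
  mulNmx mul1mx opprK.
Qed.

Lemma Lc_tr_in a b c Z : Lc a b c Z^T = Om *m Lc a c b Z *m Om^t*.
Proof.
rewrite -Lc_tr_out /Lc !linearD !linearZ /= trmx1 mxtrace_tr.
congr (_ + _ + _ *: _).
by rewrite !sharpE linearN /= !trmx_mul trmxK symp_tr mulNmx !mulmxN opprK mulmxA.
Qed.

(** [sharp] is a trace-preserving involution fixing the identity. In the first coefficient,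
    [d a + b + c] comes from the trace and [2 a] from the identity and its image under [sharp]. *)
Lemma Lc_comp a b c : Lc 1 1 1 \o Lc a b c =
  Lc ((d%:R + 2) * a + b + c) (b + c) (b + c) :> ('M_d -> 'M_d).
Proof.
apply/funext => Z /=; rewrite /Lc !linearD !linearZ /= sharpK sharp1 mxtrace_sharp.
rewrite mxtrace1; move: (sharp Z) => Z'.
by apply/matrixP => i j; rewrite !mxE; ring.
Qed.

Lemma choi_at1 a b c :
  choi a b c 1%:M = d%:R * (a + d%:R * b - c).
Proof.
rewrite /choi sharp1 /frob trmx1 map_mx1 mulmx1 mxtrace1 rmorph_nat; ring.
Qed.

End Choi.

(** * Covariant maps *)

Section Covariance.
Variables (C : numClosedFieldType) (m : nat).
Local Notation d := (m + m)%N.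
Local Notation Om := (symp C m).


Definition sympl (S : 'M[C]_d) := S \is unitarymx /\ S^T *m Om *m S = Om.

(** For unitary [S] the symplectic relation reads [Om S = conj(S) Om]; in this form it shows that
    [sharp] commutes with conjugation by [S]. *)
Lemma sympl_sharp_adj (S : 'M[C]_d) : sympl S -> sharp (S^t*) = S.
Proof.
case=> Su Ss; have SS : S *m S^t* = 1%:M by apply/unitarymxP.
have cSS : map_mx Num.conj S *m S^T = 1%:M.
  rewrite -[RHS]trmx1 -SS trmx_mul; congr (_ *m _).
  by rewrite map_trmx trmxK.
have OS : Om *m S = map_mx Num.conj S *m Om.
  by rewrite -{2}Ss !mulmxA cSS mul1mx.
rewrite sharpE map_trmx trmxK -mulmxA -OS mulmxA symp_sqr.
by rewrite mulNmx mul1mx opprK.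
Qed.

Lemma Lc_covariant a b c S Z :
  sympl S -> Lc a b c (S *m Z *m S^t*) = S *m Lc a b c Z *m S^t*.
Proof.
move=> SpS; have [/unitarymxP SS _] := SpS.
have SS' : S^t* *m S = 1%:M by apply: mulmx1C.
have sh : sharp (S *m Z *m S^t*) = S *m sharp Z *m S^t*.
  rewrite !sharpM (sympl_sharp_adj SpS) mulmxA; congr (_ *m _).
  by rewrite -{1}[S]trmxCK -adj_sharp sympl_sharp_adj.
rewrite /Lc sh !mulmxDr !mulmxDl -!scalemxAr -!scalemxAl mulmx1 SS.
by rewrite mxtrace_mulC mulmxA SS' mul1mx.
Qed.

(* For unit [w]: [w |-> 'i w], [Om conj(w) |-> - 'i Om conj(w)], the identity on
   the orthogonal complement of these two vectors. *)
Definition srot (w : 'cV[C]_d) : 'M[C]_d :=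
  1%:M + ('i - 1) *: (w *m w^t*) + (- 'i - 1) *: sharp (w *m w^t*).

(** [P = w *m w^t*] and [sharp P] are mutually orthogonal projections, so [srot w] is diagonalizable
    with unimodular eigenvalues, hence unitary. *)
Lemma sympl_srot w : w^t* *m w = 1%:M -> sympl (srot w).
Proof.
move=> w1; rewrite /srot; set P := w *m w^t*.
have PP : P *m P = P by rewrite /P mulmxA -(mulmxA w) w1 mulmx1.
have Pa : P^t* = P by rewrite /P adj_mul trmxCK.
have QQ : sharp P *m sharp P = sharp P by rewrite -sharpM PP.
have Qa : (sharp P)^t* = sharp P by rewrite adj_sharp Pa.
(* A scalar equal to its own transpose, and to minus it by antisymmetry of [Om]. *)
have s0 : w^t* *m Om *m map_mx Num.conj w = 0.
  set s := _ *m _; have sT : s^T = - s.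
    rewrite /s !trmx_mul symp_tr mulNmx mulmxN mulmxA; congr (- (_ *m _ *m _)).
      by rewrite map_trmx.
    by rewrite map_trmx trmxK.
  apply/matrixP => i j; rewrite !ord1; have /matrixP/(_ 0 0) := sT.
  rewrite !mxE => /eqP; rewrite -addr_eq0 -mulr2n mulrn_eq0 /= => /eqP.
  by rewrite [X in X = _ -> _](_ : _ = s 0 0) // mxE.
have PQ : P *m sharp P = 0.
  rewrite sharpE mulmxN /P trmx_mul !mulmxA map_trmx trmxK.
  have -> : w *m w^t* *m Om *m map_mx Num.conj w = w *m 0.
    by rewrite -s0 !mulmxA.
  by rewrite mulmx0 !mul0mx oppr0.
have QP : sharp P *m P = 0 by rewrite -Qa -{2}Pa -adj_mul PQ linear0 map_mx0.
clearbody P; have Sa : (1%:M + ('i - 1) *: P + (- 'i - 1) *: sharp P)^t* =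
    1%:M + (- 'i - 1) *: P + ('i - 1) *: sharp P.
  rewrite !adj_add !adj_scale trmx1 map_mx1 Pa Qa.
  have ci : ('i - 1)^* = - 'i - 1 :> C by rewrite rmorphB /= conjCi rmorph1.
  by rewrite -{1}ci conjCK ci.
set S := _ + _ + _ in Sa *.
have ii : 'i * 'i = -1 :> C by rewrite -expr2 sqrCi.
have SS : S *m S^t* = 1%:M.
  rewrite Sa /S !mulmxDl !mulmxDr -!scalemxAl -!scalemxAr !mul1mx !mulmx1.
  rewrite PP QQ PQ QP; move: (sharp P) => Q.
  apply/matrixP => i j; rewrite !mxE; move: (P i j) (Q i j) (_%:R) => p q t.
  rewrite [LHS](_ : _ = t + (p + q) * (-1 - 'i * 'i)).
    by rewrite ii; ring.
  by ring.
split; first exact/unitarymxP.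
have SS' : S^t* *m S = 1%:M by apply: mulmx1C.
(* Passing [Om] across exchanges [P] and [sharp P] up to transposition, and their coefficients
   ['i - 1] and [- 'i - 1] are conjugate. *)
have OS : Om *m S = map_mx Num.conj S *m Om.
  have cE : map_mx Num.conj S = (S^t*)^T by rewrite map_trmx trmxK.
  have cP : Om *m sharp P = P^T *m Om.
    by rewrite sharpE mulmxN !mulmxA symp_sqr !mulNmx mul1mx opprK.
  have cQ : (sharp P)^T *m Om = Om *m P.
    rewrite sharpE linearN /= !trmx_mul trmxK symp_tr !(mulNmx, mulmxN) !opprK.
    by rewrite mulmxA mulsympK opprK.
  rewrite cE Sa /S !mulmxDr !linearD !linearZ /= trmx1 !mulmxDl mul1mx mulmx1.
  rewrite -!scalemxAl cP cQ.
  by rewrite addrAC.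
rewrite -mulmxA OS mulmxA.
suff -> : S^T *m map_mx Num.conj S = 1%:M by rewrite mul1mx.
by rewrite -[RHS]trmx1 -SS' trmx_mul map_trmx trmxK.
Qed.


(** [Om] is a signed permutation matrix: [partner] is its permutation and [psign] gives its signs by
    row. *)
Definition partner (i : 'I_d) : 'I_d :=
  match split i with inl a => rshift m a | inr b => lshift m b end.

Definition psign (i : 'I_d) : C := if (i < m)%N then 1 else -1.

Lemma partner_lshift (a : 'I_m) : partner (lshift m a) = rshift m a.
Proof. by rewrite /partner -[lshift m a]/(unsplit (inl a)) unsplitK. Qed.

Lemma partner_rshift (a : 'I_m) : partner (rshift m a) = lshift m a.
Proof. by rewrite /partner -[rshift m a]/(unsplit (inr a)) unsplitK. Qed.

Lemma psign_lshift (a : 'I_m) : psign (lshift m a) = 1.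
Proof. by rewrite /psign /= ltn_ord. Qed.

Lemma psign_rshift (a : 'I_m) : psign (rshift m a) = -1.
Proof. by rewrite /psign /= ltnNge leq_addr. Qed.

Lemma partnerK : involutive partner.
Proof.
move=> i; case: (split_ordP i) => a ->;
  by rewrite !(partner_lshift, partner_rshift).
Qed.

Lemma partner_neq i : partner i != i.
Proof.
case: (split_ordP i) => a ->; rewrite ?(partner_lshift, partner_rshift).
  by rewrite eq_rlshift.
by rewrite eq_lrshift.
Qed.

Lemma psign_partner i : psign (partner i) = - psign i.
Proof.
case: (split_ordP i) => a ->; rewrite ?(partner_lshift, partner_rshift);
  by rewrite psign_lshift psign_rshift ?opprK.
Qed.

Lemma psign_sqr i : psign i * psign i = 1.
Proof. by rewrite /psign; case: ifP => _; rewrite ?mulrNN mulr1. Qed.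

Lemma psign_conj i : (psign i)^* = psign i.
Proof. by rewrite /psign; case: ifP => _; rewrite ?rmorphN1 ?rmorph1. Qed.

Local Notation e_ i := (delta_mx i 0 : 'cV[C]_d).

Lemma sympE i j : Om i j = psign i * (j == partner i)%:R.
Proof.
rewrite /symp; case: (split_ordP i) => a ->; case: (split_ordP j) => b ->;
  rewrite ?(partner_lshift, partner_rshift) ?(psign_lshift, psign_rshift);
  rewrite ?(block_mxEul, block_mxEur, block_mxEdl, block_mxEdr) !mxE;
  rewrite ?(eq_lshift, eq_rshift, eq_lrshift, eq_rlshift) ?mulr0 //.
  by rewrite mul1r eq_sym.
by rewrite mulN1r eq_sym.
Qed.

Lemma symp_delta i : Om *m e_ i = - psign i *: e_ (partner i).
Proof.
apply/matrixP => k l; rewrite ord1 -colE mxE sympE !mxE eqxx andbT.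
have [->|ki] := eqVneq k (partner i).
  by rewrite psign_partner partnerK eqxx.
rewrite mulr0 (_ : i == _ = false) ?mulr0 //; apply/eqP => ik.
by rewrite ik partnerK eqxx in ki.
Qed.

(** On rank-one matrices [sharp] exchanges the two vectors and applies to each the antiunitary map
    [v |-> Om conj(v)]. *)
Lemma sharp_rank1 (u v : 'cV[C]_d) :
  sharp (u *m v^t*) = (Om *m map_mx Num.conj v) *m (Om *m map_mx Num.conj u)^t*.
Proof.
have vE : (v^t*)^T = map_mx Num.conj v by rewrite map_trmx trmxK.
have uE : (map_mx Num.conj u)^t* = u^T.
  by apply/matrixP => i j; rewrite !mxE conjCK.
by rewrite /sharp trmx_mul adj_mul vE uE !mulmxA.
Qed.

Lemma delta_rank1 i j : e_ i *m (e_ j)^t* = delta_mx i j.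
Proof. by rewrite trmx_delta map_delta_mx mul_delta_mx. Qed.

Lemma sharp_delta i :
  sharp (delta_mx i i : 'M[C]_d) = delta_mx (partner i) (partner i).
Proof.
rewrite -delta_rank1 sharp_rank1 map_delta_mx symp_delta adj_scale.
rewrite -scalemxAl -scalemxAr scalerA rmorphN /= psign_conj mulrNN psign_sqr.
by rewrite scale1r delta_rank1.
Qed.

Lemma delta_inner i j : (e_ i)^t* *m e_ j = (i == j)%:R%:M.
Proof.
rewrite trmx_delta map_delta_mx; apply/matrixP => k l.
by rewrite !ord1 -rowE !mxE eqxx andbT eq_sym.
Qed.

Lemma srot_mul (w v : 'cV[C]_d) (x y : C) :
  w^t* *m v = x%:M -> (Om *m map_mx Num.conj w)^t* *m v = y%:M ->
  srot w *m v = v + (('i - 1) * x) *: w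
    + ((- 'i - 1) * y) *: (Om *m map_mx Num.conj w).
Proof.
move=> wv jv; rewrite /srot sharp_rank1 !mulmxDl mul1mx -!scalemxAl.
by rewrite -(mulmxA w) -(mulmxA (Om *m _)) wv jv !mul_mx_scalar !scalerA.
Qed.

(** A rotation [srot w] with [w] in the span of [e_ i] and [e_ j]. The free phase [t] serves to
    separate matrix units, the fixed vectors to stay inside a stabilizer. *)
Lemma sympl_mix i j : i != j -> exists x y : C, [/\ x != 0, y != 0 &
  forall t, t * t^* = 1 -> exists S,
    [/\ sympl S, S *m e_ i = x *: e_ i + (y * t) *: e_ j
    & forall k, k != i -> k != j -> k != partner i -> k != partner j ->
        S *m e_ k = e_ k]].
Proof.
move=> ij.
(* The triple 3, 4, 5 makes [w t] a unit vector with rational moduli for every phase [t]. *)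
pose w t := (3 / 5 : C) *: e_ i + (4 / 5 * t) *: e_ j.
have conj35 : (3 / 5 : C)^* = 3 / 5 by rewrite rmorphM fmorphV !rmorph_nat.
have conj45 : (4 / 5 : C)^* = 4 / 5 by rewrite rmorphM fmorphV !rmorph_nat.
have wa t : (w t)^t* = (3 / 5) *: (e_ i)^t* + (4 / 5 * t^*) *: (e_ j)^t*.
  by rewrite adj_add !adj_scale conj35 rmorphM /= conj45.
have jw t : Om *m map_mx Num.conj (w t) =
    - (3 / 5 * psign i) *: e_ (partner i)
    - (4 / 5 * t^* * psign j) *: e_ (partner j).
  rewrite map_mxD !map_mxZ /= !map_delta_mx conj35 rmorphM /= conj45.
  rewrite mulmxDr -!scalemxAr !symp_delta !scalerA !mulrN !scaleNr.
  by [].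
have jwa t : (Om *m map_mx Num.conj (w t))^t* =
    - (3 / 5 * psign i) *: (e_ (partner i))^t*
    - (4 / 5 * t * psign j) *: (e_ (partner j))^t*.
  rewrite jw -!scaleNr adj_add !adj_scale !rmorphN !rmorphM /= !psign_conj.
  by rewrite conjCK !fmorphV !rmorph_nat.
have we t k : (w t)^t* *m e_ k =
    (3 / 5 * (i == k)%:R + 4 / 5 * t^* * (j == k)%:R)%:M.
  by rewrite wa mulmxDl -!scalemxAl !delta_inner !scale_scalar_mx -raddfD.
have jwe t k : (Om *m map_mx Num.conj (w t))^t* *m e_ k =
    (- (3 / 5 * psign i) * (partner i == k)%:R
     - 4 / 5 * t * psign j * (partner j == k)%:R)%:M.
  rewrite jwa -scaleNr mulmxDl -!scalemxAl !delta_inner.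
  rewrite !scale_scalar_mx -raddfD /=.
  by rewrite !mulNr.
have w1 t : t * t^* = 1 -> (w t)^t* *m w t = 1%:M.
  move=> tt; rewrite {2}/w mulmxDr -!scalemxAr !we !eqxx.
  rewrite (negPf ij) (eq_sym j i) (negPf ij).
  rewrite !scale_scalar_mx -raddfD /=; congr (_%:M).
  rewrite [LHS](_ : _ = 9 / 25 + 16 / 25 * (t * t^*)); last by field.
  by rewrite tt; field.
have fixed t k : k != i -> k != j -> k != partner i -> k != partner j ->
    srot (w t) *m e_ k = e_ k.
  move=> ki kj kpi kpj; rewrite (srot_mul (we t k) (jwe t k)).
  rewrite !(eq_sym _ k) (negPf ki) (negPf kj) (negPf kpi) (negPf kpj).
  by rewrite !(mulr0, subr0, addr0, scale0r).
(* If [j] is the partner of [i], then [Om conj(w)] lies in the same plane and both rotated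
   directions contribute; otherwise it is orthogonal to [e_ i]. *)
have [pj|pj] := eqVneq (partner i) j.
  have pj' : partner j = i by rewrite -pj partnerK.
  have sj : psign j = - psign i by rewrite -pj psign_partner.
  exists (- (7 / 25 * 'i)), (24 / 25 * 'i); split.
  - by rewrite oppr_eq0 !mulf_neq0 ?invr_eq0 ?neq0Ci ?pnatr_eq0.
  - by rewrite !mulf_neq0 ?invr_eq0 ?neq0Ci ?pnatr_eq0.
  move=> t tt; exists (srot (w t)); split; [exact/sympl_srot/w1| |exact: fixed].
  rewrite (srot_mul (we t i) (jwe t i)) jw pj pj' sj eqxx (eq_sym j) (negPf ij).
  apply/matrixP => k l; rewrite !mxE.
  rewrite /=; move: (psign i) (psign_sqr i) => s ss.
  move: ((k == i) && _)%:R ((k == j) && _)%:R => ei ej.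
  rewrite [LHS](_ : _ = ei + ('i - 1) * (9 / 25 * ei + 12 / 25 * t * ej)
    + (- 'i - 1) * (16 / 25 * (t * t^*) * (s * s) * ei
                      - 12 / 25 * (s * s) * t * ej)).
    by rewrite tt ss; field.
  by field.
have i1 : 'i - 1 != 0 :> C.
  rewrite subr_eq0; apply/eqP => i1; have := sqrCi C; rewrite i1 expr1n.
  by move/eqP; rewrite -addr_eq0 -mulr2n pnatr_eq0.
have nz2 : 1 + 9 / 25 * ('i - 1) != 0 :> C.
  apply/eqP => h; have hi : 'i = - (16 / 9) :> C.
    apply/eqP; rewrite -addr_eq0; apply/eqP.
    rewrite -[RHS](mulr0 (25 / 9)) -h; by field.
  have := sqrCi C; rewrite hi => /eqP; rewrite -addr_eq0.
  rewrite (_ : _ + 1 = 337 / 81); last by field.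
  by rewrite mulf_eq0 invr_eq0 !pnatr_eq0.
exists (1 + 9 / 25 * ('i - 1)), (12 / 25 * ('i - 1)); split => //.
  by rewrite !mulf_neq0 ?invr_eq0 ?pnatr_eq0.
move=> t tt; exists (srot (w t)); split; [exact/sympl_srot/w1| |exact: fixed].
have pji : partner j != i by apply/eqP => pji; rewrite -pji partnerK eqxx in pj.
rewrite (srot_mul (we t i) (jwe t i)) eqxx (eq_sym j) (negPf ij) (negPf pji).
rewrite (negPf (partner_neq i)) !mulr0 subr0 mulr0 scale0r addr0 addr0.
by apply/matrixP => k l; rewrite !mxE /=; field.
Qed.

(** * Rigidity of covariant maps *)

Section Covariant.
Variable L : {linear 'M[C]_d -> 'M[C]_d}.
Hypothesis L_cov : forall S Z : 'M[C]_d, sympl S ->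
  L (S *m Z *m S^t*) = S *m L Z *m S^t*.

(** Conjugating [delta_mx i i] by the matrices of [sympl_mix] gives a trigonometric polynomial in
    the phase [t] that [L] annihilates; hence its coefficients vanish. *)
Lemma covariant_delta_eq0 i j : i != j ->
  L (delta_mx i i) = 0 -> L (delta_mx j j) = 0 /\ L (delta_mx i j) = 0.
Proof.
move=> ij Lii; have [x [y [x0 y0 mix]]] := sympl_mix ij.
have E t : t * t^* = 1 ->
    (x * (y * t)^*) *: L (delta_mx i j) + (y * t * x^*) *: L (delta_mx j i)
    + (y * t * (y * t)^*) *: L (delta_mx j j) = 0.
  move=> /mix [S [SpS Si _]]; have := L_cov (delta_mx i i) SpS.
  rewrite Lii mulmx0 mul0mx -delta_rank1 mulmxA Si -mulmxA -adj_mul Si.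
  rewrite adj_add !adj_scale mulmxDl !mulmxDr -!scalemxAl -!scalemxAr !scalerA.
  by rewrite !delta_rank1 !linearD !linearZ /= Lii scaler0 add0r addrA.
have ii : 'i * 'i = -1 :> C by rewrite -expr2 sqrCi.
suff h r s : L (delta_mx j j) r s = 0 /\ L (delta_mx i j) r s = 0.
  by split; apply/matrixP => r s; rewrite mxE; case: (h r s).
have x0' : x^* != 0 by rewrite conjC_eq0.
have y0' : y^* != 0 by rewrite conjC_eq0.
pose A := y * y^* * L (delta_mx j j) r s.
pose B := x * y^* * L (delta_mx i j) r s.
pose D := y * x^* * L (delta_mx j i) r s.
have F t : t * t^* = 1 -> t^* * B + t * D + A = 0.
  move=> tt; have /matrixP/(_ r s) := E t tt; rewrite !mxE rmorphM /=.
  rewrite (_ : y * t * (y^* * t^*) = y * y^* * (t * t^*)); last by ring.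
  by rewrite tt mulr1 => <-; rewrite /A /B /D; ring.
have F1 : B + D + A = 0 by have := F 1; rewrite rmorph1 !mul1r; apply.
have F2 : - B - D + A = 0.
  by have := F (-1); rewrite rmorphN1 mulrNN !mulN1r mul1r; apply.
have F3 : - 'i * B + 'i * D + A = 0.
  by have := F 'i; rewrite conjCi mulrN ii opprK; apply.
(* The phases 1 and -1 isolate [A]; then 1 and ['i] isolate [B]. *)
have A0 : A = 0.
  apply/eqP; suff: A *+ 2 == 0 by rewrite mulrn_eq0.
  by apply/eqP; rewrite -[RHS]addr0 -{1}F1 -F2; ring.
have B0 : B = 0.
  apply/eqP; suff: B *+ 2 == 0 by rewrite mulrn_eq0.
  apply/eqP; rewrite A0 !addr0 in F1 F3.
  have -> : B *+ 2 = (B + D) + 'i * (- 'i * B + 'i * D) + (1 + 'i * 'i) * (B - D).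
    by ring.
  by rewrite F1 F3 ii; ring.
split; apply/eqP.
  by move/eqP: A0; rewrite !mulf_eq0 (negPf y0) (negPf y0').
by move/eqP: B0; rewrite !mulf_eq0 (negPf x0) (negPf y0').
Qed.

(** Applied to a difference, this says that a covariant map is determined by its value at one
    diagonal matrix unit. *)
Lemma covariant_eq0 i : L (delta_mx i i) = 0 -> forall Z, L Z = 0.
Proof.
move=> Li; have Ld j : L (delta_mx j j) = 0.
  have [<-//|ij] := eqVneq i j.
  by have [] := covariant_delta_eq0 ij Li.
move=> Z; rewrite [Z]matrix_sum_delta !linear_sum big1 // => k _.
rewrite linear_sum big1 // => l _; rewrite linearZ /=.
have [->|kl] := eqVneq k l; first by rewrite Ld scaler0.
by have [_ ->] := covariant_delta_eq0 kl (Ld k); rewrite scaler0.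
Qed.

(* [N] commutes with the stabilizer of the line spanned by [e_ i], which forces
   it to be diagonal and constant off [i] and [partner i]. *)
Lemma covariant_delta i j (N := L (delta_mx i i)) : j != i -> j != partner i ->
  N = N j j *: 1%:M + (N i i - N j j) *: delta_mx i i
    + (N (partner i) (partner i) - N j j) *: delta_mx (partner i) (partner i).
Proof.
move=> ji jpi.
have comm S z : sympl S -> S *m e_ i = z *: e_ i -> z * z^* = 1 ->
    S *m N = N *m S.
  move=> SpS Si zz; have := L_cov (delta_mx i i) SpS.
  rewrite -{1}delta_rank1 mulmxA Si -mulmxA -adj_mul Si adj_scale.
  rewrite -scalemxAl -scalemxAr scalerA zz scale1r delta_rank1.
  move=> /(congr1 (mulmx^~ S)).
  rewrite -/N -!mulmxA => ->; congr (_ *m _).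
  have [/unitarymxP SS _] := SpS.
  by rewrite (mulmx1C SS) mulmx1.
(* The rotation at [e_ l] is diagonal, with entry ['i] at [l] and a different entry, [- 'i] or 1,
   everywhere else; commuting with it kills [N k l]. *)
have Ndiag k l : k != l -> N k l = 0.
  move=> kl; pose S := srot (e_ l).
  have el1 : (e_ l)^t* *m e_ l = 1%:M by rewrite delta_inner eqxx.
  have SpS : sympl S := sympl_srot el1.
  pose z k : C := if k == l then 'i else if k == partner l then - 'i else 1.
  have Se p : S *m e_ p = z p *: e_ p.
    have jE : Om *m map_mx Num.conj (e_ l) = - psign l *: e_ (partner l).
      by rewrite map_delta_mx symp_delta.
    have jeE : (Om *m map_mx Num.conj (e_ l))^t* *m e_ p =
        (- psign l * (partner l == p)%:R)%:M.
      rewrite jE adj_scale -scalemxAl delta_inner rmorphN /= psign_conj.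
      by rewrite scale_scalar_mx.
    rewrite (srot_mul (delta_inner l p) jeE) jE /z scalerA.
    have -> : (- 'i - 1) * (- psign l * (partner l == p)%:R) * - psign l =
        (- 'i - 1) * (partner l == p)%:R * (psign l * psign l) by ring.
    rewrite psign_sqr mulr1; have [<-|pl] := eqVneq p l.
      rewrite (negPf (partner_neq _)) mulr0 scale0r addr0 mulr1.
      by rewrite -{1}[delta_mx p 0]scale1r -scalerDl addrC subrK.
    rewrite eq_sym in pl; rewrite eq_sym; have [->|ppl] := eqVneq p (partner l).
      rewrite mulr0 scale0r addr0 mulr1.
      by rewrite -{1}[delta_mx _ 0]scale1r -scalerDl addrC subrK.
    by rewrite !mulr0 !scale0r !addr0 scale1r.
  have Sz a b : S a b = z b * (a == b)%:R.
    by have /matrixP/(_ a 0) := Se b; rewrite -colE !mxE andbT.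
  have zz p : z p * (z p)^* = 1.
    rewrite /z; case: ifP => _; first by rewrite conjCi mulrN -expr2 sqrCi opprK.
    case: ifP => _; last by rewrite rmorph1 mulr1.
    by rewrite rmorphN /= conjCi opprK mulNr -expr2 sqrCi opprK.
  have /matrixP/(_ k l) := comm S (z i) SpS (Se i) (zz i).
  rewrite !mxE (bigD1 k) //= [in RHS](bigD1 l) //= !Sz !eqxx !mulr1.
  rewrite !big1 ?addr0; last 2 first.
  - by move=> p pl; rewrite Sz (negPf pl) !mulr0.
  - by move=> p pk; rewrite Sz eq_sym (negPf pk) mulr0 mul0r.
  rewrite /z eqxx (negPf kl) => /eqP.
  rewrite [N k l * _]mulrC -subr_eq0 -mulrBl mulf_eq0.
  case: ifP => _ /orP[|/eqP//].
    by rewrite -opprD oppr_eq0 -mulr2n mulrn_eq0 /= (negPf (neq0Ci _)).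
  rewrite subr_eq0 => /eqP i1; have := sqrCi C; rewrite -i1 expr1n.
  by move/eqP; rewrite -addr_eq0 -mulr2n pnatr_eq0.
have mulN A a b : (A *m N) a b = A a b * N b b.
  rewrite mxE (bigD1 b) //= big1 ?addr0 // => p pb.
  by rewrite Ndiag ?mulr0.
have Nmul A a b : (N *m A) a b = N a a * A a b.
  rewrite mxE (bigD1 a) //= big1 ?addr0 // => p pa.
  by rewrite Ndiag ?mul0r // eq_sym.
(* A rotation mixing [e_ j] and [e_ p] fixes [e_ i]; its nonzero entry at [(p, j)] forces the two
   diagonal entries of [N] to agree. *)
have Nconst p : p != i -> p != partner i -> N p p = N j j.
  move=> p_i ppi; have [->//|pj] := eqVneq p j.
  rewrite eq_sym in pj; have [x [y [x0 y0 mix]]] := sympl_mix pj.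
  have [|S [SpS Sj Sfix]] := mix 1; first by rewrite rmorph1 mulr1.
  have Si : S *m e_ i = 1 *: e_ i.
    rewrite scale1r Sfix // 1?eq_sym //; apply/eqP => pp.
      by rewrite -pp partnerK eqxx in jpi.
    by rewrite -pp partnerK eqxx in ppi.
  have Spj : S p j = y.
    have /matrixP/(_ p 0) := Sj.
    rewrite -colE !mxE !eqxx !andbT (eq_sym p) (negPf pj).
    by rewrite /= mulr0 add0r !mulr1.
  have /matrixP/(_ p j) := comm S 1 SpS Si (ltac:(by rewrite rmorph1 mulr1)).
  by rewrite mulN Nmul Spj mulrC => /(mulIf y0).
apply/matrixP => k l; rewrite !mxE.
have [<-|kl] := eqVneq k l; last first.
  rewrite Ndiag // mulr0 add0r.
  have [ki|_] := eqVneq k i.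
    rewrite -ki in kl *; rewrite (eq_sym l) (negPf kl) (eq_sym k).
    by rewrite (negPf (partner_neq k)) !mulr0 addr0.
  rewrite mulr0 add0r; have [kpi|_] := eqVneq k (partner i); last first.
    by rewrite mulr0.
  by rewrite -kpi (eq_sym l) (negPf kl) mulr0.
have [->|ki] := eqVneq k i.
  by rewrite (eq_sym i) (negPf (partner_neq i)) !mulr1 mulr0 addr0 addrC subrK.
have [->|kpi] := eqVneq k (partner i).
  by rewrite !mulr1 mulr0 addr0 addrC subrK.
by rewrite (Nconst k) // mulr1 !mulr0 !addr0.
Qed.

End Covariant.

(** The coefficients are chosen so that [L] and [Lc a b c] agree at [delta_mx i i]; [2 <= m]
    provides an index [j] other than [i] and its partner. *)
Lemma covariant_Lc (L : {linear 'M[C]_d -> 'M[C]_d}) : (2 <= m)%N ->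
  (forall S Z : 'M[C]_d, sympl S -> L (S *m Z *m S^t*) = S *m L Z *m S^t*) ->
  exists a b c, forall Z, L Z = Lc a b c Z.
Proof.
move=> m_ge2 L_cov.
pose i : 'I_d := lshift m (Ordinal (ltnW m_ge2)).
pose j : 'I_d := lshift m (Ordinal m_ge2).
pose N := L (delta_mx i i).
pose a := N j j; pose b := N i i - a; pose c := N (partner i) (partner i) - a.
exists a, b, c => Z; apply/eqP; rewrite -subr_eq0; apply/eqP.
apply: (@covariant_eq0 (L \- Lc a b c) _ i _ Z) => /= [S Y SpS|].
  by rewrite L_cov // Lc_covariant // mulmxBr mulmxBl.
rewrite /Lc (covariant_delta L_cov (_ : j != i) (_ : j != partner i)) //; last first.
  by rewrite partner_lshift eq_lrshift.
rewrite -/N -/a -/b -/c sharp_delta (_ : \tr _ = 1) ?mulr1 ?subrr //.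
by rewrite -delta_rank1 mxtrace_mulC delta_inner eqxx mxtrace1.
Qed.

End Covariance.

(** * Positivity and decomposability *)

Section KPositive.
Variable R : realType.
Local Notation C := R[i].

Lemma psdP n (A : 'M[C]_n) :
  psd A <-> forall v : 'cV_n, 0 <= (v^t* *m A *m v) 0 0.
Proof.
by split=> [[]//|A_ge0]; split=> //; apply: form_ge0_hermsym.
Qed.

Lemma adj_self_ge0 (z : 'M[C]_1) : 0 <= (z^t* *m z) 0 0.
Proof. by rewrite mxE big_ord1 !mxE mulrC mul_conjC_ge0. Qed.

Lemma psd_rank1 n (u : 'cV[C]_n) : psd (u *m u^t*).
Proof.
apply/psdP => v; rewrite mulmxA -mulmxA.
have -> : v^t* *m u = (u^t* *m v)^t* by rewrite adj_mul trmxCK.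
exact: adj_self_ge0.
Qed.

(** The spectral theorem; each weight is the value of the form at a unit eigenvector. *)
Lemma psd_sum_rank1 n (A : 'M[C]_n) : psd A ->
  exists D : 'I_n -> C, exists u : 'I_n -> 'cV[C]_n,
    (forall r, 0 <= D r) /\ A = \sum_r D r *: (u r *m (u r)^t*).
Proof.
case=> Ah A_ge0; have /orthomx_spectralP := hermitian_normalmx Ah.
set P := spectralmx A; set D := spectral_diag A => AE.
have Pu : P \is unitarymx by apply: spectral_unitarymx.
rewrite invmx_unitary // in AE.
have PP : P *m P^t* = 1%:M by apply/unitarymxP.
have AEs : A = \sum_r D 0 r *: (col r (P^t*) *m (col r (P^t*))^t*).
  rewrite {1}AE; apply/matrixP=> i j; rewrite !mxE summxE.
  apply: eq_bigr => r _.
  rewrite mul_mx_diag !mxE big_ord1 !mxE conjCK mulrCA mulrA.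
  by rewrite mulrC mulrCA mulrA.
exists (fun r => D 0 r), (fun r => col r (P^t*)); split=> // r.
have := A_ge0 (col r (P^t*)).
suff -> : ((col r (P^t*))^t* *m A *m col r (P^t*)) 0 0 = D 0 r by [].
have -> : (col r (P^t*))^t* = row r P.
  by apply/rowP => j; rewrite !mxE conjCK.
rewrite colE rowE mulmxA -!(mulmxA (delta_mx 0 r)).
have -> : P *m A *m P^t* = diag_mx D.
  by rewrite AE !mulmxA PP mul1mx -mulmxA PP mulmx1.
by rewrite mulmxA -rowE -colE !mxE eqxx mulr1n.
Qed.

Section Quad.
Variables (k d : nat).

Definition unblock (u : 'cV[C]_(\sum_(a < k) d)) : 'M[C]_(d, k) :=
  \matrix_(i, a) submxcol u a i 0.

Definition block (W : 'M[C]_(d, k)) : 'cV[C]_(\sum_(a < k) d) :=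
  \mxcol_(a < k) col a W.

Lemma col_unblock u a : col a (unblock u) = submxcol u a.
Proof. by apply/colP => i; rewrite !mxE. Qed.

Lemma blockK W : unblock (block W) = W.
Proof. by apply/matrixP => i a; rewrite mxE mxcolK mxE. Qed.

Lemma form_mxblock (B : 'I_k -> 'I_k -> 'M[C]_d)
    (v : 'cV[C]_(\sum_(a < k) d)) :
  (v^t* *m (\mxblock_(a < k, b < k) B a b) *m v) 0 0 =
  \sum_a \sum_b ((submxcol v a)^t* *m B a b *m submxcol v b) 0 0.
Proof.
have vE : v^t* = \mxrow_(a < k) (submxcol v a)^t*.
  by apply/mxrowP => a; rewrite mxrowK; apply/matrixP => s t; rewrite !mxE.
rewrite vE -{2}(submxcolK v) mul_mxrow_mxblock mul_mxrow_mxcol summxE.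
rewrite exchange_big /=; apply: eq_bigr => b _.
by rewrite mulmx_suml summxE; apply: eq_bigr.
Qed.

Lemma form_id_tens (L : 'M[C]_d -> 'M[C]_d) u v :
  (v^t* *m id_tens L (u *m u^t*) *m v) 0 0 = quad L (unblock u) (unblock v).
Proof.
have uuE a b : submxblock (u *m u^t*) a b = submxcol u a *m (submxcol u b)^t*.
  by apply/matrixP => i j; rewrite !mxE; apply: eq_bigr => r _; rewrite !mxE.
rewrite form_mxblock; apply: eq_bigr => a _; apply: eq_bigr => b _.
by rewrite uuE !col_unblock.
Qed.

(** By the spectral decomposition it suffices to test positivity on rank-one [X]. *)
Lemma k_positiveP (L : {linear 'M[C]_d -> 'M[C]_d}) :
  k_positive k L <-> forall W V : 'M[C]_(d, k), 0 <= quad L W V.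
Proof.
split=> [Lk W V|L_ge0 X /psd_sum_rank1 [D [u [D_ge0 XE]]]].
  by rewrite -[W]blockK -[V]blockK -form_id_tens;
    case: (Lk _ (psd_rank1 (block W))) => _; apply.
apply/psdP => v.
have -> : id_tens L X = \sum_r D r *: id_tens L (u r *m (u r)^t*).
  rewrite XE; apply/mxblockP => a b; rewrite mxblockK.
  rewrite !submxblock_sum linear_sum; apply: eq_bigr => r _.
  have subZ t (Y : 'M[C]_(\sum_(a < k) d)) :
    submxblock (t *: Y) a b = t *: submxblock Y a b.
    by apply/matrixP => i j; rewrite !mxE.
  by rewrite !subZ linearZ mxblockK.
rewrite mulmx_sumr mulmx_suml summxE; apply: sumr_ge0 => r _.
rewrite -scalemxAr -scalemxAl mxE form_id_tens.
by rewrite mulr_ge0.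
Qed.

End Quad.

Lemma k_positive_add k d (L1 L2 : 'M[C]_d -> 'M[C]_d) :
  k_positive k L1 -> k_positive k L2 -> k_positive k (fun Z => L1 Z + L2 Z).
Proof.
move=> L1k L2k X Xpsd; apply/psdP => v.
have -> : id_tens (fun Z => L1 Z + L2 Z) X = id_tens L1 X + id_tens L2 X.
  by rewrite /id_tens mxblockD.
rewrite mulmxDr mulmxDl mxE addr_ge0 //.
  by case: (L1k X Xpsd) => _; apply.
by case: (L2k X Xpsd) => _; apply.
Qed.

Lemma k_positive_comp k d (L1 L2 : 'M[C]_d -> 'M[C]_d) :
  k_positive k L1 -> k_positive k L2 -> k_positive k (L1 \o L2).
Proof.
move=> L1k L2k X /L2k/L1k; rewrite /id_tens.
by under eq_mxblock => a b do rewrite mxblockK.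
Qed.

(** [S] is absorbed into the blocks of the test vector. *)
Lemma k_positive_conj k d (S : 'M[C]_d) (L : 'M[C]_d -> 'M[C]_d) :
  k_positive k L -> k_positive k (fun Z => S *m L Z *m S^t*).
Proof.
move=> Lk X /Lk [_ X_ge0]; apply/psdP => v.
have := X_ge0 (\mxcol_(a < k) (S^t* *m submxcol v a)).
rewrite !form_mxblock; congr (_ <= _); apply: eq_bigr => a _.
by apply: eq_bigr => b _; rewrite !mxcolK adj_mul trmxCK !mulmxA.
Qed.

End KPositive.

(** * CP, co-CP and decomposable members of the family *)

Section LcPositivity.
Variables (R : realType) (m : nat).
Local Notation C := R[i].
Local Notation d := (m + m)%N.
Local Notation Om := (symp C m).
Local Notation Lc := (@Lc C m).

Lemma k_positive_LcP k a b c :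
  k_positive k (Lc a b c) <->
  forall W V : 'M[C]_(d, k), 0 <= choi a b c (W *m V^t*).
Proof.
by rewrite k_positiveP; split=> h W V; have := h W V; rewrite quad_Lc.
Qed.

Lemma CP_Lc_add s t : (0 < m)%N -> 0 <= s -> 0 <= t ->
  CP (Lc (m%:R * s) (t - s) (- (m%:R * s))).
Proof.
move=> m_gt0 s_ge0 t_ge0 k; apply/k_positive_LcP => W V.
exact: choi_extreme_ge0.
Qed.

Lemma CP_Lc1 : CP (Lc 1 1 1).
Proof. by move=> k; apply/k_positive_LcP => W V; apply: choi1_ge0. Qed.

Lemma coCP_Lc a b c : CP (Lc a c b) -> coCP (Lc a b c).
Proof.
move=> cp k; rewrite (_ : (fun _ => _) = fun Z => Om *m Lc a c b Z *m Om^t*).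
  by apply: k_positive_conj; apply: cp.
by apply/funext => Z; rewrite Lc_tr_out.
Qed.

(** Weights [s] on [(m, -1, -m)] and [t] on [(m, -m, -1)] must add up to [a]; the remainders in [b]
    and [c] weigh [(0, 1, 0)] and [(0, 0, 1)] and must be nonnegative. *)
Lemma decomposable_Lc (a b c : R) : (2 <= m)%N ->
  0 <= a -> 0 <= a + b -> 0 <= a + c ->
  0 <= (m%:R + 1) * a + m%:R * (b + c) ->
  decomposable (Lc a%:C%C b%:C%C c%:C%C).
Proof.
move=> m_ge2 a_ge0 ab_ge0 ac_ge0 mabc_ge0.
have m_ge2' : 2 <= m%:R :> R by rewrite (ler_nat _ 2).
have m_neq0 : m%:R != 0 :> R by lra.
have m1_gt0 : 0 < m%:R - 1 :> R by lra.
suff [s [t [s_ge0 t_ge0 stE mu_ge0 nu_ge0]]] : exists s t : R,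
    [/\ 0 <= s, 0 <= t, m%:R * s + m%:R * t = a,
      0 <= b + s + m%:R * t & 0 <= c + m%:R * s + t].
  have m_gt0 := ltnW m_ge2.
  exists (Lc (m%:R * s%:C%C)
    ((b + s + m%:R * t)%:C%C - s%:C%C) (- (m%:R * s%:C%C))).
  exists (Lc (m%:R * t%:C%C) (- (m%:R * t%:C%C))
    ((c + m%:R * s + t)%:C%C - t%:C%C)).
  split.
  - by apply: CP_Lc_add => //; rewrite ler0c.
  - by apply: coCP_Lc; apply: CP_Lc_add => //; rewrite ler0c.
  move=> Z /=; rewrite /Lc.
  rewrite -stE !(rmorphD, rmorphM) /= !rmorph_nat.
  move: (sharp Z) => Z'; apply/matrixP => i j; rewrite !mxE; ring.
(* In this case [t = 0] suffices, the remainder in [c] being [a + c]. *)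
case: (leP 0 (b + a / m%:R)) => hb.
  exists (a / m%:R), 0; split; rewrite ?mulr0 ?addr0 //.
  - by rewrite divr_ge0 // ler0n.
  - by rewrite mulrCA divff ?mulr1.
  - by rewrite mulrCA divff ?mulr1 // addrC.
(* Otherwise [s] and [t] solve [s + t = a / m] and [b + s + m t = 0], so that the last hypothesis is
   exactly what the remainder in [c] requires. *)
exists ((a + b) / (m%:R - 1)), (- (b + a / m%:R) / (m%:R - 1)).
have e1 : b + (a + b) / (m%:R - 1) + m%:R * (- (b + a / m%:R) / (m%:R - 1)) = 0.
  by field; rewrite m_neq0 lt0r_neq0.
have e2 : c + m%:R * ((a + b) / (m%:R - 1)) + (- (b + a / m%:R) / (m%:R - 1)) =
  ((m%:R + 1) * a + m%:R * (b + c)) / m%:R.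
  by field; rewrite m_neq0 lt0r_neq0.
split; rewrite ?e1 ?e2 //.
- by rewrite divr_ge0 // ltW.
- by rewrite divr_ge0 ?oppr_ge0 ?ltW.
- by field; rewrite m_neq0 lt0r_neq0.
- by rewrite divr_ge0 // ler0n.
Qed.

(* [Lc 1 1 1] is CP also after transposing its argument, so composing it with a
   decomposable map gives a CP map, whose Choi form is evaluated at [1%:M]. *)
Lemma decomposable_Lc_ge0 a b c : (0 < m)%N ->
  decomposable (Lc a b c) -> 0 <= (m%:R + 1) * a + m%:R * (b + c).
Proof.
move=> m_gt0 [L1 [L2 [L1cp L2cp LE]]].
have cp : CP (Lc 1 1 1 \o Lc a b c).
  move=> k.
  have cp1 : k_positive k (Lc 1 1 1 \o L1) :=
    k_positive_comp (@CP_Lc1 k) (L1cp k).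
  have cp2 : k_positive k (Lc 1 1 1 \o fun Z => (L2 Z)^T) :=
    k_positive_comp (@CP_Lc1 k) (L2cp k).
  (* The last two coefficients of [Lc 1 1 1] agree, so undoing the transposition inside it only
     conjugates by [Om]. *)
  have := k_positive_add cp1 (k_positive_conj Om cp2).
  congr k_positive; apply/funext => Z /=.
  by rewrite -Lc_tr_in trmxK LE linearD.
rewrite Lc_comp in cp; have /k_positive_LcP/(_ 1%:M 1%:M) := cp d.
rewrite trmx1 map_mx1 mul1mx choi_at1 natrD => h.
have m0 : 0 < m%:R :> C by rewrite ltr0n.
(* The Choi form at the identity is [4 m] times the claimed quantity. *)
have m4 : 0 < 4 * m%:R :> C by rewrite mulr_gt0 ?ltr0n.
rewrite -(pmulr_rge0 _ m4); congr (0 <= _): h; ring.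
Qed.


End LcPositivity.

(** * Real coefficients and the indecomposable region *)

Section RealParameters.
Variables (R : realType) (m : nat).
Hypothesis m_ge2 : (2 <= m)%N.
Local Notation C := R[i].
Local Notation d := (m + m)%N.
Local Notation Lr a b c := (@Lc C m a%:C%C b%:C%C c%:C%C).
Local Notation M := (m%:R : R).

Let M_ge2 : 2 <= M. Proof. by rewrite (ler_nat _ 2). Qed.

Lemma ge0_complexE (z : C) : 0 <= z -> z = (complex.Re z)%:C%C.
Proof. by move=> /ger0_real /RRe_real <-. Qed.

Lemma LpqE p q : @Lpq R d p q = Lr ((1 - p - q) / d%:R) p q.
Proof.
apply/funext => Z; rewrite /Lpq /Lc /sharp Omega_block.
by rewrite rmorphM fmorphV rmorph_nat mulrAC mulrA.
Qed.

(** Positivity makes [a], [a + b] and [a + c] nonnegative complex numbers, hence real. *)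
Lemma covariant_real (L : {linear 'M[C]_d -> 'M[C]_d}) k : (0 < k)%N ->
  SS_covariant L -> k_positive k L ->
  exists a b c : R, L = Lr a b c :> (_ -> _).
Proof.
move=> k_gt0 L_cov Lk.
have [a [b [c LE]]] : exists a b c, forall Z, L Z = Lc a b c Z.
  apply: covariant_Lc => // S Z [Su Ss]; apply: L_cov; split=> //.
  by rewrite Omega_block.
have {}LE : L = Lc a b c :> (_ -> _) by apply/funext.
rewrite LE in Lk *; have /k_positive_LcP choi_ge0 := Lk.
have a_ge0 := choi_a_ge0 k_gt0 choi_ge0 m_ge2.
have ab_ge0 := choi_ab_ge0 k_gt0 choi_ge0 (ltnW m_ge2).
have ac_ge0 := choi_ac_ge0 k_gt0 choi_ge0 (ltnW m_ge2).
exists (complex.Re a), (complex.Re (a + b) - complex.Re a).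
exists (complex.Re (a + c) - complex.Re a).
by rewrite !rmorphB /= -!ge0_complexE // !(addrC a) !addrK.
Qed.

Variables (a b c : R).

Lemma k_positive_real_ineq k : (0 < k <= m)%N -> k_positive k (Lr a b c) ->
  [/\ 0 <= a, 0 <= a + b, 0 <= a + c & 0 <= a + k%:R * b].
Proof.
move=> /andP[k_gt0 k_le] /k_positive_LcP choi_ge0; split.
- by have := choi_a_ge0 k_gt0 choi_ge0 m_ge2; rewrite ler0c.
- by have := choi_ab_ge0 k_gt0 choi_ge0 (ltnW m_ge2); rewrite -rmorphD ler0c.
- by have := choi_ac_ge0 k_gt0 choi_ge0 (ltnW m_ge2); rewrite -rmorphD ler0c.
have := choi_akb_ge0 k_gt0 choi_ge0 k_le.
by rewrite -[k%:R](rmorph_nat (real_complex R)) -rmorphM -rmorphD ler0c.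
Qed.

Lemma k_positive_real k : (0 < k <= m)%N ->
  c <= 0 -> 0 <= a + c -> 0 <= a + k%:R * b -> k_positive k (Lr a b c).
Proof.
move=> k_bnd c_le0 ac_ge0 akb_ge0; apply/k_positive_LcP => W V.
apply: choi_rank_ge0 => //; rewrite -?[k%:R](rmorph_nat (real_complex R)).
- by rewrite lecE /= eqxx.
- by rewrite -rmorphD ler0c.
- by rewrite -rmorphM -rmorphD ler0c.
Qed.

Lemma decomposable_real_ge0 :
  decomposable (Lr a b c) -> 0 <= (M + 1) * a + M * (b + c).
Proof.
move=> /(decomposable_Lc_ge0 (ltnW m_ge2)).
by rewrite -[m%:R](rmorph_nat (real_complex R)) -(rmorph1 (real_complex R))
  -!(rmorphD, rmorphM) ler0c.
Qed.

Lemma half_positive_decomposable :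
  k_positive m (Lr a b c) -> decomposable (Lr a b c).
Proof.
case/k_positive_real_ineq => [|a_ge0 ab_ge0 ac_ge0 amb_ge0].
  by rewrite (ltnW m_ge2) leqnn.
apply: decomposable_Lc => //.
have -> : (M + 1) * a + M * (b + c) = (a + M * b) + M * (a + c) by ring.
by rewrite addr_ge0 // mulr_ge0.
Qed.

(** The hypotheses force [0 <= a], [b <= 0] and [c <= 0]. The last makes [k_positive_real]
    applicable, and [b <= 0] passes the bound at [m - 1] on to smaller [k]. *)
Lemma indecomposable_region k : (0 < k <= m - 1)%N ->
  0 <= a + c -> 0 <= a + (M - 1) * b -> (M + 1) * a + M * (b + c) < 0 ->
  k_positive k (Lr a b c) /\ indecomposable (Lr a b c).
Proof.
move=> k_bnd ac_ge0 amb_ge0 lt0; split; last first.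
  by move=> /decomposable_real_ge0; rewrite leNgt lt0.
have k_le : k%:R <= M - 1.
  by rewrite -(natrB _ (ltnW m_ge2)) ler_nat; case/andP: k_bnd.
have a_ge0 : 0 <= a.
  have M2 := M_ge2; have M0 : 0 <= M by lra.
  have M1 : 0 <= M - 1 by lra.
  have h1 : 0 <= M * (M - 1) * (a + c) by rewrite !mulr_ge0.
  have h2 : 0 <= M * (a + (M - 1) * b) by rewrite mulr_ge0.
  have h3 : (M - 1) * ((M + 1) * a + M * (b + c)) <= 0.
    by rewrite mulr_ge0_le0 // ltW.
  (* In this combination of the three hypotheses [b] and [c] cancel. *)
  have e : a = M * (M - 1) * (a + c) + M * (a + (M - 1) * b)
      - (M - 1) * ((M + 1) * a + M * (b + c)) by ring.
  by rewrite e subr_ge0 (le_trans h3) // addr_ge0.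
have M0 : 0 < M by have := M_ge2; lra.
have Mac : 0 <= M * (a + c) by rewrite mulr_ge0 // ltW.
have b_le0 : b <= 0 by rewrite -(pmulr_rle0 _ M0); lra.
have Mab : 0 <= M * (a + (M - 1) * b) by rewrite mulr_ge0 // ltW.
have M2 := M_ge2; have M1 : 0 < M - 1 by lra.
have MM : 0 <= (M * (M - 1) - 1) * a by rewrite mulr_ge0 //; nra.
have c_le0 : c <= 0.
  rewrite -(pmulr_rle0 _ (mulr_gt0 M0 M1)).
  have h : (M - 1) * ((M + 1) * a + M * (b + c)) <= 0.
    by rewrite pmulr_rle0 // ltW.
  have -> : M * (M - 1) * c = (M - 1) * ((M + 1) * a + M * (b + c))
      - M * (a + (M - 1) * b) - (M * (M - 1) - 1) * a by ring.
  by lra.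
apply: k_positive_real => //; first lia.
by rewrite (le_trans amb_ge0) // lerD2l ler_wnM2r.
Qed.

End RealParameters.

(** Rewrites the stated inequalities for [b = p] and [c = q] by clearing denominators with
    [D a = 1 - p - q], [D = 2 M] and the positivity of [D ^+ 2 - D - 2]. *)
Lemma region_real (R : realType) (m : nat) (p q : R) (M := m%:R : R)
    (D := (m + m)%N%:R : R) (a := (1 - p - q) / D) : (2 <= m)%N ->
  [/\ (p + q < - ((2 + D) / (D ^+ 2 - D - 2))) =
        ((M + 1) * a + M * (p + q) < 0),
      (p + (1 - D) * q <= 1) = (0 <= a + q) &
      ((1 - (D / 2 - 1) * D) * p + q <= 1) = (0 <= a + (M - 1) * p)].
Proof.
move=> m_ge2; have M_ge2 : 2 <= M by rewrite (ler_nat _ 2).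
have DM : D = M + M by rewrite /D natrD.
have D_gt0 : 0 < D by lra.
have D0 : D != 0 by rewrite gt_eqF.
have aE : D * a = 1 - p - q by rewrite /a mulrC divfK.
have X_gt0 : 0 < D ^+ 2 - D - 2 by rewrite expr2; nra.
split.
- rewrite -mulNr ltr_pdivlMr // -subr_gt0 -oppr_lt0.
  have -> : - (- (2 + D) - (p + q) * (D ^+ 2 - D - 2)) =
      (D + D) * ((M + 1) * a + M * (p + q)).
    have -> : (D + D) * ((M + 1) * a + M * (p + q)) =
        (M + 1) *+ 2 * (D * a) + (D + D) * M * (p + q) by ring.
    by rewrite aE DM; ring.
  by rewrite pmulr_rlt0 // addr_gt0.
- rewrite -(pmulr_rge0 _ D_gt0) mulrDr aE -subr_ge0; congr (0 <= _); ring.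
- rewrite -(pmulr_rge0 (a + _) D_gt0) mulrDr aE -subr_ge0; congr (0 <= _).
  by rewrite DM; field.
Qed.

Theorem corollary3p6 (R : realType) (d : nat) (d_ge4 : (4 <= d)%N)
    (d_even : ~~ odd d) :
  [/\ forall k : nat, (1 <= k <= d./2 - 1)%N ->
        PP R d k `\` DD R d !=set0,
      PP R d d./2 `<=` DD R d,
      PP R d (d./2 - 1) `\` DD R d =
        [set x : R * R | let: (p, q) := x in
          [/\ p + q < - ((2 + d%:R) / (d%:R ^+ 2 - d%:R - 2)),
              p + (1 - d%:R) * q <= 1 &
              (1 - (d%:R / 2 - 1) * d%:R) * p + q <= 1]],
      forall p q : R,
        p + q < - ((2 + d%:R) / (d%:R ^+ 2 - d%:R - 2)) ->
        p + (1 - d%:R) * q <= 1 ->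
        (1 - (d%:R / 2 - 1) * d%:R) * p + q <= 1 ->
        [/\ linear (@Lpq R d p q),
            k_positive (d./2 - 1) (@Lpq R d p q) &
            indecomposable (@Lpq R d p q)] &
      forall L : {linear 'M[R[i]]_d -> 'M[R[i]]_d},
        SS_covariant L -> k_positive d./2 L -> decomposable L].

Proof.
have [m dE] : exists m, d = (m + m)%N.
  by exists d./2; rewrite addnn even_halfK.
subst d; have m_ge2 : (2 <= m)%N by lia.
have mE : (m + m)./2 = m by rewrite addnn doubleK.
rewrite mE {mE}.
have region p q := @region_real R m p q m_ge2.
have Pindec p q k : (1 <= k <= m - 1)%N ->
    p + q < - ((2 + (m + m)%:R) / ((m + m)%:R ^+ 2 - (m + m)%:R - 2)) ->
    p + (1 - (m + m)%:R) * q <= 1 ->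
    (1 - ((m + m)%:R / 2 - 1) * (m + m)%:R) * p + q <= 1 ->
    k_positive k (@Lpq R (m + m) p q) /\ indecomposable (@Lpq R (m + m) p q).
  move=> k_bnd; have [-> -> ->] := region p q => h1 h2 h3.
  by rewrite LpqE; apply: indecomposable_region.
have m1_bnd : (1 <= m - 1 <= m - 1)%N by lia.
split.
- move=> k k_bnd; pose M := m%:R : R.
  have M_ge2 : 2 <= M by rewrite (ler_nat _ 2).
  (* The vertex [a + q = 0], [a + (M - 1) * p = 0] of the region, where
     [a = (1 - p - q) / (M + M)]. *)
  pose q := - ((M - 1) / (M * (2 * M - 3))).
  pose p := - (1 / (M * (2 * M - 3))).
  have M0 : M != 0 by rewrite gt_eqF //; lra.
  have M3_gt0 : 0 < 2 * M - 3 by lra.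
  have M3 : 2 * M - 3 != 0 by rewrite gt_eqF.
  have [r1 r2 r3] := region p q.
  have aq : (1 - p - q) / (m + m)%:R = - q.
    by rewrite natrD /p /q -/M; field; rewrite M0 M3 /= -mulr2n mulrn_eq0.
  have Mq : q = (M - 1) * p by rewrite /p /q; field; rewrite ?M0 ?M3.
  exists (p, q); have [] // := Pindec p q k k_bnd.
  + rewrite r1 -/M aq.
    have -> : (M + 1) * - q + M * (p + q) = - (1 / M) * (1 / (2 * M - 3)).
      by rewrite /p /q; field; rewrite ?M0 ?M3.
    by rewrite mulNr oppr_lt0 mulr_gt0 // divr_gt0 //; lra.
  + by rewrite r2 aq addNr.
  + by rewrite r3 aq -/M -Mq addNr.
- move=> [p q]; rewrite /PP /DD /= LpqE.
  exact: half_positive_decomposable.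
- apply/seteqP; split=> -[p q].
    rewrite /PP /DD /= LpqE => -[Lk indec].
    have k_bnd : (0 < m - 1 <= m)%N by lia.
    have [a_ge0 ab_ge0 ac_ge0] := k_positive_real_ineq m_ge2 k_bnd Lk.
    rewrite natrB; last lia.
    have [-> -> ->] := region p q => akb_ge0; split=> //.
    (* If the first inequality failed, all conditions for decomposability would hold. *)
    by rewrite ltNge; apply/negP => h; apply: indec; apply: decomposable_Lc.
  by move=> [h1 h2 h3]; apply: Pindec.
- move=> p q h1 h2 h3; have [Lk indec] := Pindec p q _ m1_bnd h1 h2 h3.
  by split=> //; rewrite LpqE; apply: Lc_is_linear.
move=> L L_cov Lk.
have [a [b [c LE]]] := covariant_real m_ge2 (ltnW m_ge2) L_cov Lk.
by rewrite LE in Lk *; apply: half_positive_decomposable.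
Qed.
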